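(* For any $\epsilon>0$, there exists a positive integer $n$ such that any one-pass randomized streaming algorithm that outputs an $(\epsilon,\rho)$-additive solution to the GEOMETRIC-DISCREPANCY problem for all streams of length $n$ requires $\Omega\left(\frac{1}{\epsilon}\right)$ bits of space.
   Context: GEOMETRIC-DISCREPANCY: given a stream $\mathcal{P}$ of $n$ points in $[0,1]$, report the 1-dimensional geometric discrepancy $$D_g(\mathcal{P}) := \sup_{[p,q]\subseteq[0,1]} \left| \, |[p,q]| - \frac{n_{pq}}{n}\right|,$$ where $|[p,q]|$ is the length of the interval $[p,q]$ and $n_{pq}$ is the number of points of $\mathcal{P}$ in $[p,q]$. An $(\epsilon,\rho)$-additive solution is an output $D'$ with $|D'-D_g(\mathcal{P})| \le \epsilon$ with probability at least $1-\rho$; here $\rho=\frac13$. A one-pass (insertion-only) streaming algorithm reads the points once in order and keeps only a memory state, whose size in bits is the space. The constant in $\Omega(\cdot)$ is absolute.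
   Formalization: The claim is proved for 0 < ε < 1/2 instead of any ε > 0: for ε ≥ 1/2 it is false, since the discrepancy lies in [0,1] and the constant answer 1/2 is a solution using 0 bits of space. *)

(* Defs.v *)
From HB Require Import structures.
From mathcomp Require Import all_boot all_order all_algebra.
From mathcomp Require Import all_classical all_reals all_analysis.
Set Implicit Arguments.
Unset Strict Implicit.
Unset Printing Implicit Defensive.
Import Order.TTheory GRing.Theory Num.Theory.
Local Open Scope classical_set_scope.
Local Open Scope ring_scope.

(* A stream is a sequence, so repeated points are allowed and are counted with
   multiplicity. *)
Definition is_stream (R : realType) (n : nat) (xs : seq R) : bool :=
  (size xs == n) && all (fun x => 0 <= x <= 1) xs.

Definition interval_discrepancy (R : realType) (xs : seq R) (p q : R) : R :=
  `| (q - p) - (count (fun x => p <= x <= q) xs)%:R / (size xs)%:R |.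

(* For a nonempty stream this is a supremum of a nonempty set bounded by 1, so
   the total operator [sup] is the genuine supremum. *)
Definition geometric_discrepancy (R : realType) (xs : seq R) : R :=
  sup [set interval_discrepancy xs pq.1 pq.2 |
        pq in [set pq : R * R | 0 <= pq.1 /\ pq.1 <= pq.2 /\ pq.2 <= 1]].

(* One-pass randomized algorithms with [s] bits of memory. The sample space
   [T] is the random tape. It is not charged as memory, and every phase may
   read all of it. The number [t] of points read so far is also free: this is
   what lets a step use fresh coins, from the [t]-th portion of the tape.
   Conventional (private-coin, unclocked) algorithms are thus a special case,
   and a lower bound for this class applies to them. *)
Record streaming_algorithm (R : realType) (T : Type) (s : nat) :=
  StreamingAlgorithm {
    alg_init : T -> s.-tuple bool ;
    alg_step : nat -> T -> s.-tuple bool -> R -> s.-tuple bool ;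
    alg_output : T -> s.-tuple bool -> R }.

Fixpoint run_from (R : realType) (T : Type) (s : nat)
    (A : streaming_algorithm R T s) (w : T) (t : nat) (m : s.-tuple bool)
    (xs : seq R) : s.-tuple bool :=
  if xs is x :: xs' then run_from A w t.+1 (alg_step A t w m x) xs' else m.

Definition run (R : realType) (T : Type) (s : nat)
    (A : streaming_algorithm R T s) (xs : seq R) (w : T) : R :=
  alg_output A w (run_from A w 0 (alg_init A w) xs).

(* The success event is required to be measurable for its probability to make
   sense: [P] is a total function on sets. *)
Definition additive_solution (R : realType) (d : measure_display)
    (T : measurableType d) (P : probability T R) (s : nat)
    (A : streaming_algorithm R T s) (n : nat) (eps rho : R) : Prop :=
  forall xs : seq R, is_stream n xs ->
    let success :=
      [set w : T | `| run A xs w - geometric_discrepancy xs | <= eps] in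
    measurable success /\ ((1 - rho)%:E <= P success)%E.

(* Main.v *)
(** Reduction from the one-way communication problem INDEX.  Alice holds
    [x : {0,1}^N] and puts one point at [(2j + x_j)/2N] for each [j < N]; Bob,
    holding [i], appends [N] copies of [(2i+1)/2N].  The discrepancy of the
    resulting stream of [2N] points is exactly [(N + x_i)/2N], attained on
    [[(2i + x_i)/2N, (2i+1)/2N]], so an error below [1/4N] reveals [x_i], and the
    memory after Alice's points is a one-way message for INDEX.  If such a message
    takes [S] values and, for some fixed tape, recovers 2/3 of all pairs [(x, i)],
    then comparing [2^(number of recovered bits)] averaged over [x] with its value
    for a fixed answer vector gives [2^N 2^(2N/3) <= S 3^N], hence [S] is
    exponential in [N].  For large [eps] it is enough to exclude zero memory,
    using one stream of discrepancy 1 and one of discrepancy at most [1/n]. *)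

Require Import Defs.
From HB Require Import structures.
From mathcomp Require Import all_boot all_order all_algebra.
From mathcomp Require Import all_classical all_reals all_analysis.
From mathcomp Require Import measurable_realfun zify ring lra.
Set Implicit Arguments.
Unset Strict Implicit.
Unset Printing Implicit Defensive.
Import Order.TTheory GRing.Theory Num.Theory.

(** * Prefix counts of the streams of Alice and Bob *)

Lemma count_ltn_iota (a n : nat) : count (fun k => k < a) (iota 0 n) = minn a n.
Proof.
elim: n => [|n IHn]; first by rewrite minn0.
by rewrite -addn1 iotaD count_cat IHn /= add0n; case: ltnP; lia.
Qed.

Lemma count_ltn_ord (a n : nat) :
  count (fun k : 'I_n => k < a) (enum 'I_n) = minn a n.
Proof. by rewrite -count_ltn_iota -val_enum_ord count_map. Qed.

(* Numerators of Alice's points, and below of Bob's, over [2N]. *)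
Definition index_stream (N : nat) (x : {ffun 'I_N -> bool}) : seq nat :=
  [seq j.*2 + x j | j : 'I_N <- enum 'I_N].

Definition query_stream (N i : nat) : seq nat := nseq N i.*2.+1.

Section IndexStream.
Variables (N : nat) (x : {ffun 'I_N -> bool}) (i : 'I_N).

Lemma size_index_query : size (index_stream x ++ query_stream N i) = N.*2.
Proof. by rewrite size_cat size_map size_enum_ord size_nseq addnn. Qed.

Lemma index_query_le : all (fun k => k <= N.*2) (index_stream x ++ query_stream N i).
Proof.
rewrite all_cat all_map; apply/andP; split.
  by apply/allP => j _ /=; have := ltn_ord j; case: (x j); lia.
by apply/allP => k /nseqP[-> _]; have := ltn_ord i; lia.
Qed.

Lemma count_index_lt_ge (a m : nat) :
  (forall j : 'I_N, j < a -> j.*2 + x j < m) ->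
  minn a N <= count (fun k => k < m) (index_stream x).
Proof.
by move=> am; rewrite count_map -count_ltn_ord; apply: sub_count => j; exact: am.
Qed.

Lemma count_index_lt_le (m : nat) :
  count (fun k => k < m) (index_stream x) <= uphalf m.
Proof.
apply: (leq_trans _ (geq_minl (uphalf m) N)).
by rewrite count_map -count_ltn_ord; apply: sub_count => j /=; lia.
Qed.

Lemma count_query_lt (m : nat) :
  count (fun k => k < m) (query_stream N i) = (i.*2.+1 < m) * N.
Proof. exact: count_nseq. Qed.

(** With [index_query_prefix_le] this bounds the deficit of prefix counts by [i + x i] and their
    excess by [N - i]; the two sum to [N + x i], the numerator of the discrepancy. *)
Lemma index_query_prefix_ge (m : nat) : m <= N.*2 ->
  m <= count (fun k => k < m) (index_stream x ++ query_stream N i) + (i + x i).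
Proof.
move=> mN; rewrite count_cat count_query_lt; have iN := ltn_ord i.
have half_le : minn m./2 N <= count (fun k => k < m) (index_stream x).
  by apply: count_index_lt_ge => j; case: (x j); lia.
(* The bound [m./2] is one short only at [m = 2i+1] with [x i] false; there Alice's own point [2i]
   lies below [m]. *)
have [/andP[/eqP mi /negbTE xi]|] := boolP ((m == i.*2.+1) && ~~ x i).
  have : minn i.+1 N <= count (fun k => k < m) (index_stream x).
    apply: count_index_lt_ge => j; rewrite ltnS leq_eqVlt => /orP[/eqP/val_inj->|].
      by rewrite xi mi; lia.
    by case: (x j); lia.
  lia.
by case: (ltnP i.*2.+1 m); case: (x i); lia.
Qed.

Lemma index_query_prefix_le (m : nat) :
  count (fun k => k <= m) (index_stream x ++ query_stream N i) <= m + (N - i).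
Proof.
have iN := ltn_ord i; rewrite count_cat.
have := count_index_lt_le m.+1; have := count_query_lt m.+1.
rewrite !(eq_count (a2 := fun k => k <= m)) // => ->.
by case: (ltnP i.*2.+1 m.+1); lia.
Qed.

(** Bob's [N] copies and Alice's [i]-th point all fall in this cell, of length [(1 - x_i)/2N], so
    the count exceeds the length by at least [(N + x_i)/2N]. *)
Lemma index_query_cell :
  N.+1 <= count (fun k => i.*2 + x i <= k <= i.*2.+1) (index_stream x ++ query_stream N i).
Proof.
rewrite count_cat count_nseq leqnn andbT -addn1 addnC.
have -> : i.*2 + x i <= i.*2.+1 by case: (x i); lia.
rewrite mul1n leq_add2r -has_count; apply/hasP; exists (i.*2 + x i).
  by apply/mapP; exists i; rewrite ?mem_enum.
by case: (x i); lia.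
Qed.

End IndexStream.

(** * Counting bound for codes that recover two thirds of the bits *)

(* The tangent inequality [2^(u - a) >= 1 + (u - a)], valid for integers, with
   both sides multiplied and shifted so that no subtraction occurs. *)
Lemma tangent_exp2 (a u : nat) : 2 ^ a * u.+1 <= 2 ^ u + a * 2 ^ a.
Proof.
have [au|ua] := leqP a u.
  have : u - a < 2 ^ (u - a) by exact: ltn_expl.
  have -> : 2 ^ u = 2 ^ (u - a) * 2 ^ a by rewrite -expnD subnK.
  by nia.
by have := leq_mul (leqnn (2 ^ a)) ua; lia.
Qed.

(** The weight is a product over coordinates, and each contributes [2 + 1] whatever [y i] is. *)
Lemma sum_exp2_agreement (N : nat) (y : 'I_N -> bool) :
  \sum_(x : {ffun 'I_N -> bool}) 2 ^ (\sum_i (y i == x i)) = 3 ^ N.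
Proof.
transitivity (\sum_(x : {ffun 'I_N -> bool}) \prod_i 2 ^ (y i == x i)).
  by apply: eq_bigr => x _; rewrite expn_sum.
rewrite -(bigA_distr_bigA (fun i b => 2 ^ (y i == b))) /=.
rewrite (eq_bigr (fun=> 3)) ?prod_nat_const ?card_ord // => i _.
by rewrite big_bool; case: (y i).
Qed.

Lemma index_code_bound (M N : nat) (Mem : finType)
    (enc : {ffun 'I_N -> bool} -> Mem) (dec : Mem -> 'I_N -> bool) :
  N = 3 * M ->
  2 * (2 ^ N * N) <=
    3 * #|[pred xi : {ffun 'I_N -> bool} * 'I_N | dec (enc xi.1) xi.2 == xi.1 xi.2]| ->
  2 ^ N * 2 ^ (2 * M) <= #|Mem| * 3 ^ N.
Proof.
move=> NM; pose g x := \sum_i (dec (enc x) i == x i).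
have -> : #|[pred xi : {ffun 'I_N -> bool} * 'I_N |
    dec (enc xi.1) xi.2 == xi.1 xi.2]| = \sum_x g x.
  rewrite pair_big /= -sum1_card big_mkcond /=.
  by apply: eq_bigr => -[x i] _; rewrite inE /=; case: eqP.
move=> agree.
have avg : 2 ^ N * (2 * M) <= \sum_x g x by move: agree; rewrite {2}NM; lia.
have cardX : #|{: {ffun 'I_N -> bool}}| = 2 ^ N.
  by rewrite card_ffun card_bool card_ord.
(* Jensen's inequality, through the tangent at the average number [2 * M] of recovered bits. *)
have lower : 2 ^ N * 2 ^ (2 * M) <= \sum_x 2 ^ g x.
  have : \sum_x 2 ^ (2 * M) * (g x).+1 <= \sum_x (2 ^ g x + 2 * M * 2 ^ (2 * M)).
    by apply: leq_sum => x _; exact: tangent_exp2.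
  rewrite big_split /= sum_nat_const -big_distrr /=.
  under eq_bigr do rewrite -addn1.
  rewrite big_split /= sum1_card cardX mulnDr => le_sum.
  have := leq_mul (leqnn (2 ^ (2 * M))) avg; move: le_sum.
  move: (2 ^ (2 * M)) (2 ^ N) (\sum_x g x) (\sum_x 2 ^ g x) => p b t r.
  by lia.
apply: (leq_trans lower).
(* Enlarging the single message [enc x] to a sum over all messages frees the answer vector from
   [x]. *)
apply: (@leq_trans (\sum_(m : Mem) \sum_(x : {ffun 'I_N -> bool})
    2 ^ (\sum_i (dec m i == x i)))).
  rewrite exchange_big /=; apply: leq_sum => x _.
  by rewrite (bigD1 (enc x)) //= leq_addr.
by under eq_bigr do rewrite sum_exp2_agreement; rewrite sum_nat_const.
Qed.

Lemma leq_of_expn_growth (t u K s : nat) :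
  0 < t -> 2 * t <= u -> u ^ K <= 2 ^ s * t ^ K -> K <= s.
Proof.
move=> t0 tu us.
have : (2 * t) ^ K <= u ^ K by case: (posnP K) => [->|K0]; rewrite ?expn0 ?leq_exp2r.
rewrite expnMn => /leq_trans/(_ us).
by rewrite leq_pmul2r ?expn_gt0 ?t0 // leq_exp2l.
Qed.

Lemma index_bits_bound (K N s : nat) (enc : {ffun 'I_N -> bool} -> s.-tuple bool)
    (dec : s.-tuple bool -> 'I_N -> bool) :
  N = 15 * K ->
  2 * (2 ^ N * N) <=
    3 * #|[pred xi : {ffun 'I_N -> bool} * 'I_N | dec (enc xi.1) xi.2 == xi.1 xi.2]| ->
  K <= s.
Proof.
move=> NK agree; have := @index_code_bound (5 * K) N _ enc dec _ agree.
rewrite card_tuple card_bool NK => /(_ ltac:(lia)).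
(* The choice of 15: [2^(25K) <= 2^s * 3^(15K)] yields [K <= s] because [2 * 3^15 <= 2^25]. *)
rewrite -expnD (_ : 15 * K + 2 * (5 * K) = 25 * K); last by lia.
rewrite (expnM 2) (expnM 3); apply: leq_of_expn_growth; clear; lia.
Qed.

Local Open Scope classical_set_scope.
Local Open Scope ring_scope.

(** * Discrepancy of streams on a grid *)

Section Discrepancy.
Variable R : realType.
Implicit Types (xs : seq R) (p q : R).

Lemma geometric_discrepancy_le xs (b : R) :
  (forall p q, 0 <= p -> p <= q -> q <= 1 -> interval_discrepancy xs p q <= b) ->
  geometric_discrepancy xs <= b.
Proof.
move=> le_b; apply: ge_sup.
  by exists (interval_discrepancy xs 0 0), (0, 0) => //=; rewrite lexx ler01.
by move=> _ [[p q] /= [p0 [pq q1]] <-]; exact: le_b.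
Qed.

Lemma interval_discrepancy_le xs p q : 0 <= p -> p <= q -> q <= 1 ->
  interval_discrepancy xs p q <= geometric_discrepancy xs.
Proof.
move=> p0 pq q1; apply: ub_le_sup; last by exists (p, q).
exists 1 => _ [[a b] /= [a0 [ab b1]] <-]; rewrite /interval_discrepancy.
set c := _ / _; have c0 : 0 <= c by rewrite divr_ge0.
have c1 : c <= 1.
  rewrite /c; have [->|] := posnP (size xs); first by rewrite invr0 mulr0 ler01.
  by move=> n0; rewrite ler_pdivrMr ?ltr0n // mul1r ler_nat count_size.
by rewrite ler_norml; apply/andP; split; lra.
Qed.

Definition grid_stream (n : nat) (ks : seq nat) : seq R :=
  [seq k%:R / n%:R | k <- ks].

Lemma grid_stream_is_stream n ks : size ks = n -> all (fun k => k <= n)%N ks ->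
  is_stream n (grid_stream n ks).
Proof.
move=> sz /allP kn; rewrite /is_stream size_map sz eqxx /=.
apply/allP => _ /mapP[k /[dup] k_in /kn k_le ->].
have n0 : (0 < n)%N by rewrite -sz; case: ks k_in {sz kn}.
by rewrite divr_ge0 //= ler_pdivrMr ?ltr0n // mul1r ler_nat.
Qed.

Lemma count_grid (n : nat) (ks : seq nat) p q : (0 < n)%N ->
  count (fun x => p <= x <= q) (grid_stream n ks) =
  count (fun k => p * n%:R <= k%:R <= q * n%:R) ks.
Proof.
move=> n0; rewrite count_map; apply: eq_count => k /=.
by rewrite ler_pdivlMr ?ler_pdivrMr ?ltr0n.
Qed.

Lemma nat_ceil (n : nat) (t : R) : t <= n%:R ->
  exists m : nat, [/\ (m <= n)%N, t <= m%:R &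
    forall k, (k < m)%N -> (k%:R : R) < t].
Proof.
move=> tn; have ex : exists m : nat, t <= m%:R by exists n.
case: (ex_minnP ex) => m tm min_m; exists m; split => // [|k km].
  exact: min_m.
by rewrite ltNge; apply/negP => /min_m; rewrite leqNgt km.
Qed.

Lemma nat_floor (n : nat) (t : R) : 0 <= t -> t <= n%:R ->
  exists m : nat, [/\ (m <= n)%N, m%:R <= t &
    forall k, (k%:R : R) <= t -> (k <= m)%N].
Proof.
move=> t0 tn; have /andP[mt tm] := truncn_itv t0.
exists (Num.trunc t); split => // [|k kt].
  by rewrite -(ler_nat R) (le_trans mt).
by rewrite -ltnS -(ltr_nat R) (le_lt_trans kt).
Qed.

(* On a grid the extreme values of [t - #{points <= t}/n] and of
   [t - #{points < t}/n] occur at grid points, so prefix counts suffice. *)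
Lemma grid_discrepancy_le (n u l : nat) (ks : seq nat) : (0 < n)%N -> size ks = n ->
  (forall m, (m <= n)%N -> (m <= count (fun k => k < m)%N ks + u)%N) ->
  (forall m, (m <= n)%N -> (count (fun k => k <= m)%N ks <= m + l)%N) ->
  geometric_discrepancy (grid_stream n ks) <= (u + l)%:R / n%:R.
Proof.
move=> n0 sz hu hl; have n0R : (0 : R) < n%:R by rewrite ltr0n.
pose lt_ t := count (fun k => k%:R < t :> R) ks.
pose le_ t := count (fun k => k%:R <= t :> R) ks.
have lt_ge t : t <= n%:R -> t <= (lt_ t)%:R + u%:R.
  move=> /nat_ceil[m [mn tm mlt]]; apply: (le_trans tm).
  rewrite -natrD ler_nat; apply: (leq_trans (hu m mn)).
  by rewrite leq_add2r; apply: sub_count => k /mlt.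
have le_le t : 0 <= t -> t <= n%:R -> (le_ t)%:R <= t + l%:R.
  move=> t0 /(nat_floor t0)[m [mn mt mle]].
  apply: (@le_trans _ _ (m + l)%:R); last by rewrite natrD lerD2r.
  rewrite ler_nat; apply: leq_trans (hl m mn).
  by apply: sub_count => k /mle.
have lt_le t : (lt_ t <= le_ t)%N by apply: sub_count => k /ltW.
apply: geometric_discrepancy_le => p q p0 pq q1.
rewrite /interval_discrepancy count_grid // size_map sz.
set c := count _ _; pose P := p * n%:R; pose Q := q * n%:R.
(* The interval is closed, so its count is a weak prefix count at [Q] minus a strict one at [P]. *)
have cE : (c + lt_ P = le_ Q)%N.
  rewrite /c /lt_ /le_ -count_predUI [X in (_ + X)%N](_ : _ = 0)%N ?addn0.
    apply: eq_count => k /=; rewrite -/P -/Q.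
    have PQ : P <= Q by rewrite ler_pM2r.
    case: (ltP k%:R P) => kP; rewrite ?orbF ?orbT //.
    by rewrite (le_trans (ltW kP)).
  apply/eqP; rewrite eqn0Ngt -has_count; apply/hasPn => k _ /=.
  by rewrite -/P; case: ltP; rewrite ?andbF.
have P0 : 0 <= P by rewrite mulr_ge0.
have Q0 : 0 <= Q by rewrite mulr_ge0 // (le_trans p0).
have Qn : Q <= n%:R by rewrite /Q ler_piMl.
have Pn : P <= n%:R by rewrite /P ler_piMl // (le_trans pq).
have {}cE : c%:R = (le_ Q)%:R - (lt_ P)%:R :> R by rewrite -cE natrD addrK.
(* Both [Q - le_ Q] and [P - lt_ P] lie in [[-l, u]]: [lt_le] carries each one-sided bound over to
   the other kind of count. *)
have := lt_ge _ Pn; have := lt_ge _ Qn.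
have := le_le _ P0 Pn; have := le_le _ Q0 Qn.
have := lt_le P; have := lt_le Q; rewrite -!(ler_nat R) => *.
have -> : q - p - c%:R / n%:R = (Q - P - c%:R) / n%:R.
  by rewrite /P /Q; field; rewrite gt_eqF.
rewrite normrM normfV (ger0_norm (ltW n0R)) ler_pM2r ?invr_gt0 // natrD cE.
by rewrite ler_norml; apply/andP; split; lra.
Qed.

End Discrepancy.

(** * Discrepancies of the hard streams *)

Section IndexDiscrepancy.
Variables (R : realType) (N : nat) (x : {ffun 'I_N -> bool}) (i : 'I_N).

Let xs : seq R := grid_stream R N.*2 (index_stream x ++ query_stream N i).

Lemma index_discrepancy_le : geometric_discrepancy xs <= (N + x i)%:R / N.*2%:R.
Proof.
have iN := ltn_ord i.
have -> : (N + x i)%N = (i + x i + (N - i))%N by lia.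
apply: grid_discrepancy_le; rewrite ?size_index_query //; first by lia.
  exact: index_query_prefix_ge.
by move=> m _; exact: index_query_prefix_le.
Qed.

Lemma index_discrepancy_ge : (N + x i)%:R / N.*2%:R <= geometric_discrepancy xs.
Proof.
have iN := ltn_ord i; have n0 : (0 < N.*2)%N by lia.
have n0R : (0 : R) < N.*2%:R by rewrite ltr0n.
apply: (@le_trans _ _ (interval_discrepancy xs ((i.*2 + x i)%:R / N.*2%:R)
    (i.*2.+1%:R / N.*2%:R))).
  rewrite /interval_discrepancy count_grid // size_map size_index_query.
  rewrite !divfK ?gt_eqF //; under eq_count do rewrite !ler_nat.
  have := index_query_cell x i; rewrite -(ler_nat R).
  set c := count _ _ => cN; rewrite -!mulrBl normrM normfV (ger0_norm (ltW n0R)).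
  rewrite ler_pM2r ?invr_gt0 // ler_normr; apply/orP; right.
  move: cN; rewrite -!natr1 !natrD; lra.
apply: interval_discrepancy_le.
- by rewrite divr_ge0.
- by rewrite ler_pM2r ?invr_gt0 // ler_nat; case: (x i); lia.
- by rewrite ler_pdivrMr // mul1r ler_nat; lia.
Qed.

End IndexDiscrepancy.

Lemma equispaced_discrepancy_le (R : realType) (n : nat) : (0 < n)%N ->
  geometric_discrepancy (grid_stream R n (iota 0 n)) <= n%:R^-1.
Proof.
(* Prefix counts have deficit 0 and excess at most 1. *)
move=> n0; rewrite -[_^-1]mul1r -[1]/((0 + 1)%:R).
apply: grid_discrepancy_le; rewrite ?size_iota // => m mn.
  by rewrite count_ltn_iota; lia.
by rewrite (eq_count (a2 := fun k => k < m.+1)%N) // count_ltn_iota; lia.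
Qed.

Lemma nseq0_discrepancy_ge (R : realType) (n : nat) : (0 < n)%N ->
  1 <= geometric_discrepancy (nseq n (0 : R)).
Proof.
(* The degenerate interval [[0, 0]] has length 0 and holds every point. *)
move=> n0; apply: le_trans (interval_discrepancy_le (nseq n 0) (lexx 0) (lexx 0) ler01).
rewrite /interval_discrepancy count_nseq size_nseq lexx mul1n divff ?pnatr_eq0 -?lt0n //.
by rewrite subrr sub0r normrN normr1.
Qed.

(** * Fixing the random tape *)

(** Averaging: the expected number of events that hold is at least [2/3] of [#|J|], so some tape
    attains this. *)
Lemma common_tape (R : realType) (d : measure_display) (T : measurableType d)
    (P : probability T R) (J : finType) (S : J -> set T) :
  (forall j, measurable (S j)) ->
  (forall j, ((1 - 3^-1)%:E <= P (S j))%E) ->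
  exists w, (2 * #|J| <= 3 * #|[pred j | w \in S j]|)%N.
Proof.
move=> mS PS; apply: contrapT => /forallNP few.
pose f w : \bar R := (\sum_j (\1_(S j) w)%:E)%E.
have mind j : measurable_fun [set: T] (EFin \o (\1_(S j) : T -> R)).
  by apply/measurable_EFinP; exact: measurable_indic.
have int_f : (\int[P]_w f w = \sum_j P (S j))%E.
  rewrite ge0_integral_sum //.
  by apply: eq_bigr => j _; rewrite integral_indic // setIT.
(* By integrality, failing the bound costs at least 1, which keeps [c] strictly below the mean
   although integration preserves only weak inequalities. *)
pose c : R := (2 * #|J|%:R - 1) / 3.
have f_le w : (f w <= c%:E)%E.
  have -> : f w = (#|[pred j | w \in S j]|%:R)%:E.
    rewrite /f sumEFin -sum1_card natr_sum [in RHS]big_mkcond /=; congr EFin.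
    by apply: eq_bigr => j _; rewrite indicE inE; case: (w \in S j).
  have : (3 * #|[pred j | w \in S j]| + 1 <= 2 * #|J|)%N.
    by rewrite addn1 ltnNge; apply/negP; exact: few.
  by rewrite lee_fin /c -(ler_nat R) natrD !natrM; lra.
have : (\int[P]_w f w <= \int[P]_w (cst c%:E w))%E.
  apply: ge0_le_integral => //.
    by move=> w _; apply: sume_ge0 => j _; rewrite lee_fin.
  exact: emeasurable_sum.
rewrite int_f integral_cst // [X in (_ * X)%E]probability_setT mule1.
have : (\sum_(j : J) (1 - 3^-1)%:E <= \sum_j P (S j))%E by exact: lee_sum.
move=> /le_trans le_ /le_; rewrite sumEFin lee_fin sumr_const -mulr_natr /c; lra.
Qed.

(** * Space lower bounds *)

Section Algorithm.
Variables (R : realType) (d : measure_display) (T : measurableType d).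
Variables (P : probability T R) (s : nat) (A : streaming_algorithm R T s).

Lemma run_from_cat w t m (xs ys : seq R) :
  run_from A w t m (xs ++ ys) =
  run_from A w (t + size xs) (run_from A w t m xs) ys.
Proof.
by elim: xs t m => [|x xs IHxs] t m /=; rewrite ?addn0 // IHxs addSnnS.
Qed.

Lemma common_tape_solution (n : nat) (eps : R) (J : finType) (xs : J -> seq R) :
  additive_solution P A n eps 3^-1 -> (forall j, is_stream n (xs j)) ->
  exists w, (2 * #|J| <= 3 * #|[pred j |
    (`| run A (xs j) w - geometric_discrepancy (xs j) | <= eps)%R]|)%N.
Proof.
move=> sol str.
have [||w le_w] := @common_tape R d T P J (fun j =>
  [set w | `| run A (xs j) w - geometric_discrepancy (xs j) | <= eps]).
- by move=> j; case: (sol _ (str j)).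
- by move=> j; case: (sol _ (str j)).
exists w; apply: (leq_trans le_w); rewrite leq_mul2l /=.
by apply: subset_leq_card; apply/fintype.subsetP => j; rewrite !inE.
Qed.

Lemma space_ge_index (K : nat) (eps : R) : (60 * K)%:R * eps < 1 ->
  additive_solution P A (30 * K) eps 3^-1 -> (K <= s)%N.
Proof.
set N := (15 * K)%N => epsK sol.
have N2 : (30 * K = N.*2)%N by rewrite /N; lia.
pose state w (x : {ffun 'I_N -> bool}) :=
  run_from A w 0 (alg_init A w) (grid_stream R N.*2 (index_stream x)).
(* Bob resumes at time [N] from Alice's memory; his threshold is halfway between the possible
   discrepancies [N/2N] and [(N+1)/2N]. *)
pose decode w m (i : 'I_N) : bool := (N%:R + 2^-1) / N.*2%:R <
  alg_output A w (run_from A w N m (grid_stream R N.*2 (query_stream N i))).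
pose xs (xi : {ffun 'I_N -> bool} * 'I_N) :=
  grid_stream R N.*2 (index_stream xi.1 ++ query_stream N xi.2).
have str xi : is_stream N.*2 (xs xi).
  apply: grid_stream_is_stream; [exact: size_index_query | exact: index_query_le].
rewrite N2 in sol; have [w le_w] := common_tape_solution sol str.
apply: (@index_bits_bound K N s (state w) (decode w) erefl).
rewrite card_prod card_ffun card_bool card_ord in le_w.
apply: (leq_trans le_w); rewrite leq_mul2l /=.
apply: subset_leq_card; apply/fintype.subsetP => -[x i]; rewrite !inE /=.
have n0 : (0 : R) < N.*2%:R by rewrite ltr0n; have := ltn_ord i; lia.
have := index_discrepancy_le R x i; have := index_discrepancy_ge R x i.
rewrite -/(xs (x, i)).
set D := geometric_discrepancy _ => D_ge D_le.
have {D_ge D_le} DE : D * N.*2%:R = N%:R + (x i)%:R.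
  rewrite ler_pdivlMr // in D_le; rewrite ler_pdivrMr // in D_ge.
  by apply/eqP; rewrite -natrD eq_le D_le D_ge.
rewrite /run /xs /grid_stream map_cat run_from_cat add0n size_map size_map size_enum_ord /=.
set y := alg_output _ _ _; rewrite /decode -/y ltr_pdivrMr //.
rewrite -(ler_pM2r n0) -{1}(ger0_norm (ltW n0)) -normrM mulrBl DE ler_norml.
(* Since [60K = 4N], the error is less than half the gap [1/2N]. *)
have eN : eps * N.*2%:R < 2^-1.
  move: epsK; rewrite (_ : 60 * K = 2 * N.*2)%N ?natrM; last by rewrite /N; lia.
  lra.
move=> /andP[y_ge y_le]; case: (x i) y_ge y_le => /= y_ge y_le.
  by apply/eqP; lra.
by rewrite eqbF_neg -leNgt; lra.
Qed.

(** Without memory the answer depends on the tape alone, while the hypothesis on [n] separates two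
    discrepancies by more than [2 * eps]. *)
Lemma space_gt0 (n : nat) (eps : R) : (0 < n)%N -> n%:R^-1 < 1 - 2 * eps ->
  additive_solution P A n eps 3^-1 -> (0 < s)%N.
Proof.
move=> n0 n_eps sol; rewrite lt0n; apply/eqP => s0.
pose xs (b : bool) : seq R := if b then nseq n 0 else grid_stream R n (iota 0 n).
have str b : is_stream n (xs b).
  case: b; first by rewrite /is_stream size_nseq eqxx all_nseq lexx ler01 orbT.
  apply: grid_stream_is_stream; first exact: size_iota.
  by apply/allP => k; rewrite mem_iota; lia.
have [w] := common_tape_solution sol str; rewrite card_bool => two.
(* At least [4/3] of the two streams are answered well, hence both. *)
have all_b b : `| run A (xs b) w - geometric_discrepancy (xs b) | <= eps.
  apply: contrapT => /negP nb; move: two; rewrite leqNgt => /negP; apply.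
  apply: (@leq_ltn_trans (3 * #|pred1 (~~ b)|)); last by rewrite card1.
  rewrite leq_mul2l; apply: subset_leq_card; apply/fintype.subsetP => b'.
  by rewrite !inE; case: b b' nb => -[] // /negbTE ->.
have mem0 (m m' : s.-tuple bool) : m = m'.
  by move: m m'; rewrite s0 => m m'; rewrite (tuple0 m) (tuple0 m').
have same : run A (xs true) w = run A (xs false) w.
  by rewrite /run; congr alg_output; exact: mem0.
have := all_b true; have := all_b false; rewrite same !ler_norml => /andP[_ F] /andP[G _].
have := equispaced_discrepancy_le R n0; have := nseq0_discrepancy_ge R n0.
rewrite -/(xs true) -/(xs false); lra.
Qed.

End Algorithm.

(* The bound fails for eps >= 1/2: as the discrepancy lies in [0, 1], the
   constant answer 1/2 is then a solution using no memory at all. *)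
Theorem theorem19 (R : realType) :
  exists2 c : R, 0 < c &
    forall eps : R, 0 < eps -> eps < 2^-1 ->
      exists2 n : nat, (0 < n)%N &
        forall (s : nat) (d : measure_display) (T : measurableType d)
            (P : probability T R) (A : streaming_algorithm R T s),
          additive_solution P A n eps 3^-1 -> c / eps <= s%:R.
Proof.
exists (120^-1); first by rewrite invr_gt0.
(* For [eps >= 1/120] the claimed bound is at most 1, so a single bit is enough. *)
move=> eps eps0 eps_half; have [eps_big|eps_small] := leP 120^-1 eps.
  have gap : 0 < 1 - 2 * eps by lra.
  exists (Num.trunc (1 - 2 * eps)^-1).+1 => // s d T P A sol.
  have /space_gt0 s0 : (Num.trunc (1 - 2 * eps)^-1).+1%:R^-1 < 1 - 2 * eps.
    rewrite invf_plt ?posrE ?ltr0n //.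
    have inv0 : 0 <= (1 - 2 * eps)^-1 by rewrite invr_ge0 ltW.
    by have /andP[] := truncn_itv inv0.
  rewrite ler_pdivrMr //; have := s0 _ _ _ _ _ isT sol; rewrite -(ler_nat R) => s1.
  by nra.
have e0 : 0 <= 120^-1 / eps by rewrite divr_ge0 // ltW.
(* As [K - 1 <= 1/(120 eps) < K], one gets [60 K eps <= 1/2 + 60 eps < 1]; this fixes the constant
   120. *)
have /andP[K_le K_gt] := truncn_itv e0; set K := (Num.trunc _).+1 in K_gt.
exists (30 * K)%N => // s d T P A sol.
apply: (le_trans (ltW K_gt)); rewrite ler_nat; apply: space_ge_index sol.
rewrite ler_pdivlMr // in K_le.
have -> : (60 * K)%:R = 60 * ((Num.trunc (120^-1 / eps))%:R + 1) :> R.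
  by rewrite natrM natr1.
lra.
Qed.
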